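(* Let $d\ge1$. Any set $X\subseteq\mathbb{R}^d$ with $\lambda(X)=\lambda<\infty$ and $\chi(X)=\chi$ satisfies \[ \lambda<g_d\bigl(T_{2d-2}(\chi)\bigr). \]
   Context: For $X\subseteq\mathbb{R}^d$, two points of $X$ see each other if the segment joining them is contained in $X$; $\chi(X)$ is the chromatic number of the invisibility graph $I(X)$, whose vertex set is $X$ and in which two points are adjacent if and only if they do not see each other. A one-point hole in $X$ is a point that forms a path-connected component of $\mathbb{R}^d\setminus X$; $\lambda(X)$ is the number of one-point holes in $X$. The tower function is $T_0(k)=k$, $T_h(k)=2^{T_{h-1}(k)}$. If $\chi$ is infinite, the right-hand side is understood as $\infty$. An ordered set $(q_1,\dots,q_n)$ of $n$ points in $\mathbb{R}^d$ is in same-side position if the points are in general position (any at most $d+1$ of them are affinely independent) and for every $i_1<i_2<\dots<i_d$ the points $q_{i_d+1},q_{i_d+2},\dots,q_n$ lie in a common open half-space determined by the hyperplane spanned by $q_{i_1},\dots,q_{i_d}$. Let $g_1(n)=n$. For $d>1$, $g_d(n)$ is the smallest number $g$ such that any set $P\subset\mathbb{R}^d$ of $g$ points contains either $g_{d-1}(n)$ points lying in a hyperplane or an $n$-tuple $(q_1,\dots,q_n)$ of points of $P$ in same-side position; if no such $g$ exists, $g_d(n)=\infty$.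
   Formalization: For d = 1 the set X is assumed nonempty: for the empty subset of the line, λ = 0, χ = 0 and g_1(T_0(0)) = 0, so the claimed strict inequality would read 0 < 0; the empty set remains covered for d ≥ 2. *)

(* Defs.v *)
From HB Require Import structures.
From mathcomp Require Export all_boot all_order all_algebra.
From mathcomp Require Export all_classical all_reals all_analysis.
Export Order.TTheory GRing.Theory Num.Theory numFieldNormedType.Exports.

Set Implicit Arguments.
Unset Strict Implicit.
Unset Printing Implicit Defensive.

Local Open Scope classical_set_scope.
Local Open Scope card_scope.
Local Open Scope ring_scope.

(* Elements of the extended naturals are encoded in [option nat], with [None]
   standing for infinity. *)
Definition least (P : nat -> Prop) : option nat :=
  match pselect (exists n, `[< P n >]) with
  | left ex => Some (ex_minn ex)
  | right _ => None
  end.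

Definition lt_enat (m : nat) (e : option nat) : Prop :=
  if e is Some n then (m < n)%N else True.

Fixpoint tower (h k : nat) : nat :=
  if h is h'.+1 then (2 ^ tower h' k)%N else k.

Section Visibility.
Variables (R : realType) (d : nat).
Implicit Types (X : set 'rV[R]_d) (x y p : 'rV[R]_d).

Definition sees X x y : Prop :=
  forall t : R, 0 <= t <= 1 -> X ((1 - t) *: x + t *: y).

(* Colours are natural numbers below k, rather than elements of 'I_k, so that
   the graph on the empty set is 0-colourable. *)
Definition invisibility_colorable X (k : nat) : Prop :=
  exists c : 'rV[R]_d -> nat,
    (forall x, X x -> (c x < k)%N) /\
    (forall x y, X x -> X y -> ~ sees X x y -> c x <> c y).

Definition chromatic_number X : option nat := least (invisibility_colorable X).

Definition path_joined (A : set 'rV[R]_d) x y : Prop :=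
  exists f : R -> 'rV[R]_d,
    [/\ {within `[0, 1], continuous f}, f 0 = x, f 1 = y &
        forall t : R, 0 <= t <= 1 -> A (f t)].

Definition path_component (A : set 'rV[R]_d) x : set 'rV[R]_d :=
  [set y | path_joined A x y].

Definition one_point_holes X : set 'rV[R]_d :=
  [set p | ~ X p /\ path_component (~` X) p = [set p]].

End Visibility.

Section SameSide.
Variables (R : realType) (d : nat).

Definition dot (a x : 'rV[R]_d) : R := \sum_(i < d) a 0 i * x 0 i.

(* This is a hyperplane only when [a != 0]. *)
Definition hyperplane (a : 'rV[R]_d) (b : R) : set 'rV[R]_d :=
  [set x | dot a x = b].

Definition affinely_independent k (p : 'I_k -> 'rV[R]_d) : Prop :=
  forall c : 'I_k -> R,
    \sum_i c i = 0 -> \sum_i c i *: p i = 0 -> forall i, c i = 0.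

Definition affine_hull k (p : 'I_k -> 'rV[R]_d) : set 'rV[R]_d :=
  [set x | exists2 c : 'I_k -> R, \sum_i c i = 1 & x = \sum_i c i *: p i].

(* For d >= 1 this forces the points of [q] to be pairwise distinct. *)
Definition general_position n (q : 'I_n -> 'rV[R]_d) : Prop :=
  forall k (i : 'I_k -> 'I_n),
    (k <= d.+1)%N -> injective i -> affinely_independent (q \o i).

(* The two sides of a hyperplane are exchanged by replacing (a, b) with
   (- a, - b), so it suffices to mention one of them. *)
Definition same_side n (q : 'I_n -> 'rV[R]_d) : Prop :=
  general_position q /\
  forall i : 'I_d -> 'I_n, (forall j k : 'I_d, (j < k)%N -> (i j < i k)%N) ->
    exists (a : 'rV[R]_d) (b : R), [/\ a != 0, affine_hull (q \o i) = hyperplane a b &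
      forall m : 'I_n, (forall j : 'I_d, (i j < m)%N) -> b < dot a (q m)].

(* [m] is the extended natural number of points required in a hyperplane. *)
Definition unavoidable (m : option nat) (n g : nat) : Prop :=
  forall P : set 'rV[R]_d, P #= `I_g ->
    (exists m', m = Some m' /\
       exists (Q : set 'rV[R]_d) (a : 'rV[R]_d) (b : R),
         [/\ Q `<=` P, Q #= `I_m', a != 0 & Q `<=` hyperplane a b])
    \/ (exists q : 'I_n -> 'rV[R]_d, (forall j, P (q j)) /\ same_side q).

End SameSide.

(* The value at d = 0 is a dummy. *)
Fixpoint g (R : realType) (d n : nat) {struct d} : option nat :=
  match d with
  | 0%N | 1%N => Some n
  | (_.+1 as d').+1 => least (@unavoidable R d (g R d' n) n)
  end.

(* Main.v *)
Require Import Defs.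
From mathcomp Require Import zify ring lra.

Local Open Scope classical_set_scope.
Local Open Scope card_scope.
Local Open Scope ring_scope.

(** Induction on the dimension, with the inequality read backwards: assume that
    [g_d(n)] holes are given, where [n] is at least the tower.  If enough of them
    lie in a hyperplane, the slice of the set by that hyperplane is a set of
    smaller dimension with no larger chromatic number, in which these points are
    still one-point holes ([hole_slice]).  The recursion ends on the line, where
    [n] holes give [n + 1] points no two of which see each other
    ([line_holes_lt]).

    There remains the case of [n] holes [p_0, p_1, ...] in same-side position,
    [d >= 2], listed so that for each [d] of them all the earlier ones lie on one
    side of the hyperplane that they span.  Rotate this hyperplane slightly around
    its last [d - 1] holes, so that its first hole also gets on that side.  For an
    increasing tuple [s] of [2d - 2] indices, counted from [s_0], the rotated
    hyperplanes of its [d - 1] windows of length [d] meet in a line through the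
    hole [p_(s_(d-1))] that passes close to [p_(s_(d-2))]; take the ray of that line
    that leaves [p_(s_(d-1))] on the far side.  When one more index is added to
    the tuple, the rotated hyperplane of the last window just misses
    [p_(s_(d-1))] and cuts the ray at a point [y] very near to it.  This [y] lies
    on the line of the shifted tuple [(s_1, ..., s_(2d-2))] as well, just before
    the hole [p_(s_d)] where the ray of that tuple starts ([chained_rays]).  The
    rotations are chosen one by one, by increasing first index: nonvanishing
    determinants keep all the lines transversal, and a sufficiently small rotation
    brings [y] as near to its hole as wanted.

    Near a hole, every ray consists of points of the set, since a path cannot
    leave the hole inside the complement and points of equal colour see each
    other ([ray_colorsP]).  Assign to a [(2d - 2)]-tuple the nonempty set of
    colours accumulating at its hole along its ray.  The colour of [y] belongs to
    the set of [s] but, the hole [p_(s_d)] being in between, not to the set of the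
    shifted tuple.  So this is a proper colouring of a shift graph, with at most
    [2 ^ k - 1] colours if the set has a proper [k]-colouring, and iterated
    logarithms ([shift_coloring_leq_tower]) give
    [n <= T_(2d-3)(2 ^ k - 1) < T_(2d-2)(k)]. *)

Set Implicit Arguments.
Unset Strict Implicit.
Unset Printing Implicit Defensive.

(** * Shift graphs and the tower function *)

Definition incr_below (n : nat) (s : seq nat) : bool :=
  sorted ltn s && all (gtn n) s.

Lemma towerS h k : tower h (2 ^ k) = tower h.+1 k.
Proof. by elim: h => //= h ->. Qed.

Lemma ltn_tower h j k : (j < k)%N -> (tower h j < tower h k)%N.
Proof. by move=> jk; elim: h => //= h; rewrite ltn_exp2l. Qed.

Lemma leq_tower h k : (tower h k <= tower h.+1 k)%N.
Proof. by rewrite /= ltnW // ltn_expl. Qed.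

Lemma incr_below_nth n s i : incr_below n s -> (i < size s)%N -> (nth 0 s i < n)%N.
Proof. by case/andP => _ /all_nthP; exact. Qed.

Lemma incr_below_ltn n s i j : incr_below n s -> (i < j)%N -> (j < size s)%N ->
  (nth 0 s i < nth 0 s j)%N.
Proof.
case/andP=> ss _ ij js; apply: (sorted_ltn_nth ltn_trans) => //.
by rewrite inE (ltn_trans ij).
Qed.

Lemma incr_below_rcons n s y : incr_below n s -> (0 < size s)%N ->
  (last 0 s < y)%N -> (y < n)%N -> incr_below n (rcons s y).
Proof.
case: s => // x s /andP[/= ss al] _ ly yn.
by rewrite /incr_below /= rcons_path ss /= ly all_rcons /= yn.
Qed.

Lemma incr_below_drop n s k : incr_below n s -> incr_below n (drop k s).
Proof.
case/andP=> ss al; apply/andP; split; first exact: drop_sorted.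
by apply/allP => x /mem_drop; exact/allP.
Qed.

Lemma incr_below_take n s k : incr_below n s -> incr_below n (take k s).
Proof.
case/andP=> ss al; apply/andP; split; first exact: take_sorted.
by apply/allP => x /mem_take; exact/allP.
Qed.

Lemma incr_below_behead n s : incr_below n s -> incr_below n (behead s).
Proof. by rewrite -drop1; exact: incr_below_drop. Qed.

(** Colour classes of a shift graph cost one logarithm per unit of tuple length:
    replacing the colour of a tuple by the set of colours of its extensions by
    one larger index turns a proper colouring of the (m+1)-tuples into a proper
    colouring of the m-tuples by subsets of the palette.  The palette is kept
    as a subset [B] of [C] because the application forbids the empty set, and
    this one missing colour is what makes the final inequality strict. *)
Lemma shift_coloring_leq_tower (C : finType) (B : {set C}) (n m : nat)
    (c : seq nat -> C) :
  (forall s, size s = m.+1 -> incr_below n s -> c s \in B) ->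
  (forall s, size s = m.+2 -> incr_below n s -> c (take m.+1 s) <> c (behead s)) ->
  (n <= tower m #|B|)%N.
Proof.
elim: m C B c => [|m IHm] C B c cB cneq.
  have inj : injective (fun i : 'I_n => c [:: val i]).
    have ne (i j : 'I_n) : (i < j)%N -> c [:: val i] <> c [:: val j].
      move=> ij; apply: (cneq [:: val i; val j]) => //.
      by rewrite /incr_below /= ij !ltn_ord.
    move=> i j cij; apply/val_inj; case: (ltngtP i j) => // ij.
    - by have := ne _ _ ij; rewrite cij.
    - by have := ne _ _ ij; rewrite cij.
  rewrite /= -[X in (X <= _)%N]card_ord -(card_codom inj); apply/subset_leq_card.
  apply/fintype.subsetP => _ /codomP[i ->]; apply: cB => //.
  by rewrite /incr_below /= ltn_ord.
rewrite -towerS -card_powerset.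
(* The new colour of s collects the old colours of all one-point extensions. *)
pose c' s :=
  [set a | [exists y : 'I_n, (last 0%N s < y)%N && (a == c (rcons s y))]]%SET.
apply: (IHm _ _ c') => s sz si.
  rewrite powersetE; apply/fintype.subsetP => a.
  rewrite inE => /existsP[y /andP[ly /eqP->]].
  by apply: cB; rewrite ?size_rcons ?sz // incr_below_rcons ?sz.
move/setP/(_ (c s)); rewrite !inE.
have sE : s = rcons (take m.+1 s) (nth 0%N s m.+1).
  by rewrite -take_nth ?take_oversize ?sz.
have -> : [exists y : 'I_n, (last 0%N (take m.+1 s) < y)%N &&
    (c s == c (rcons (take m.+1 s) y))].
  apply/existsP; exists (Ordinal (incr_below_nth si (eq_leq (esym sz)))) => /=.
  rewrite -sE eqxx andbT -nth_last size_take sz ltnSn nth_take //=.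
  by apply: (incr_below_ltn si); rewrite ?sz.
move=> /esym/existsP[y /andP[ly /eqP cs]].
have lE : last 0%N (behead s) = last 0%N s by case: (s) sz => [|? []].
apply: (cneq (rcons s y)).
- by rewrite size_rcons sz.
- by rewrite incr_below_rcons ?sz // -lE.
- rewrite -sz -cats1 take_size_cat // cs; congr c.
  by case: (s) sz => //= ? ? _; rewrite cats1.
Qed.

Lemma incr_below_size n s : incr_below n s -> (size s <= n)%N.
Proof.
case/andP=> ss /allP al; rewrite -[X in (_ <= X)%N](size_iota 0).
apply: uniq_leq_size => [|x /al]; last by rewrite mem_iota.
exact: (sorted_uniq ltn_trans ltnn).
Qed.

Lemma near_incr_below (T : Type) (F : set_system T) (n : nat)
    (P : seq nat -> T -> Prop) :
  Filter F ->
  (forall s, incr_below n s -> \forall x \near F, P s x) ->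
  \forall x \near F, forall s, incr_below n s -> P s x.
Proof.
move=> FF nP.
have : \forall x \near F, forall (m : 'I_n.+1) (t : m.-tuple 'I_n),
    incr_below n (map val t) -> P (map val t) x.
  apply: filter_forall => m; apply: filter_forall => t.
  have [it|/negP nit] := boolP (incr_below n (map val t)).
    by have := nP _ it; apply: filterS.
  by apply: nearW.
apply: filterS => x H s si.
have sn : (size s < n.+1)%N by rewrite ltnS incr_below_size.
have [t tE] : exists t : (size s).-tuple 'I_n, map val t = s.
  have sz : size (pmap insub s : seq 'I_n) == size s.
    rewrite size_pmap_sub -all_count; apply/allP => y ys.
    by case/andP: si => _ /allP; exact.
  exists (Tuple sz); rewrite /= (pmap_filter (@insubK _ _ _)).
  apply/all_filterP/allP => y ys; rewrite /= isSome_insub.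
  by case/andP: si => _ /allP; exact.
by rewrite -tE; apply: (H (Ordinal sn)); rewrite tE.
Qed.

(** * Affine functions and the cross product *)

Section Dot.
Variables (R : realType) (d : nat).
Implicit Types (a x y : 'rV[R]_d).

Lemma dotDr a x y : dot a (x + y) = dot a x + dot a y.
Proof. by rewrite /dot -big_split; apply: eq_bigr => i _; rewrite mxE mulrDr. Qed.

Lemma dotZr a (c : R) x : dot a (c *: x) = c * dot a x.
Proof. by rewrite /dot mulr_sumr; apply: eq_bigr => i _; rewrite mxE mulrCA. Qed.

Lemma dotNr a x : dot a (- x) = - dot a x.
Proof. by rewrite -scaleN1r dotZr mulN1r. Qed.

Lemma dotBr a x y : dot a (x - y) = dot a x - dot a y.
Proof. by rewrite dotDr dotNr. Qed.

Lemma dot0r a : dot a 0 = 0.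
Proof. by rewrite -(scale0r 0) dotZr mul0r. Qed.

Lemma dotC a x : dot a x = dot x a.
Proof. by apply: eq_bigr => i _; rewrite mulrC. Qed.

Lemma dotDl a y x : dot (a + y) x = dot a x + dot y x.
Proof. by rewrite dotC dotDr !(dotC x). Qed.

Lemma dotZl (c : R) a x : dot (c *: a) x = c * dot a x.
Proof. by rewrite dotC dotZr (dotC x). Qed.

Lemma dot_sumr (I : Type) (r : seq I) (P : pred I) (F : I -> 'rV[R]_d) a :
  dot a (\sum_(i <- r | P i) F i) = \sum_(i <- r | P i) dot a (F i).
Proof. by elim/big_rec2: _ => [|i y x _ <-]; rewrite ?dot0r ?dotDr. Qed.

Lemma dot_gt0 x : x != 0 -> 0 < dot x x.
Proof.
move=> x0; have ge i : 0 <= x 0 i * x 0 i by rewrite -expr2 sqr_ge0.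
rewrite lt_def sumr_ge0 // andbT; apply: contra_neq x0 => /psumr_eq0P xx.
apply/rowP => i; rewrite mxE; apply/eqP; rewrite -sqrf_eq0 expr2.
by rewrite xx // => j _; exact: ge.
Qed.

Definition affine_eval (u : 'rV[R]_d * R) x : R := dot u.1 x - u.2.

Lemma affine_evalD u x z : affine_eval u (x + z) = affine_eval u x + dot u.1 z.
Proof. by rewrite /affine_eval dotDr addrAC. Qed.

Lemma dot_affine u x y : dot u.1 (x - y) = affine_eval u x - affine_eval u y.
Proof. by rewrite dotBr /affine_eval opprB addrA subrK. Qed.

End Dot.

Section Continuity.
Variables (R : realType) (T : topologicalType).

Lemma continuous_sum (I : Type) (s : seq I) (P : pred I)
    (W : normedModType R) (F : I -> T -> W) (x : T) :
  (forall i, {for x, continuous (F i)}) ->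
  {for x, continuous (fun t => \sum_(i <- s | P i) F i t)}.
Proof.
move=> cF; apply: cvg_big => [|i _]; last exact: cF.
exact: add_continuous.
Qed.

Lemma continuous_det n (M : T -> 'M[R]_n) (x : T) :
  (forall i j, {for x, continuous (fun t => M t i j)}) ->
  {for x, continuous (fun t => \det (M t))}.
Proof.
move=> cM; apply: continuous_sum => s; apply: continuousM; first exact: cst_continuous.
apply: cvg_big => [|i _]; last exact: cM.
exact: mul_continuous.
Qed.

End Continuity.

Section CrossProduct.
Variables (R : realType) (e : nat).
Local Notation V := 'rV[R]_e.+1.
Implicit Types (r : nat -> V) (b z : V).

(** Replacing the last row by a free vector [b] makes the determinant a linear
    form in [b]; [cross r] represents that form, so it is the generalized cross
    product of the first [e] vectors of [r]. *)
Definition cross_mx r b : 'M[R]_e.+1 :=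
  \matrix_(i, j) (if i == ord_max then b else r i) 0 j.

Definition cross r : V := \row_j cofactor (cross_mx r 0) ord_max j.

Lemma cross_ext r r' :
  (forall i, (i < e)%N -> r i = r' i) -> cross r = cross r'.
Proof.
move=> rr; apply/rowP => k; rewrite !mxE; congr (cofactor _ _ _).
apply/matrixP => i j; rewrite !mxE; case: eqVneq => // ne; rewrite rr //.
by rewrite ltn_neqAle -ltnS ltn_ord andbT.
Qed.

Lemma dot_cross r b : dot b (cross r) = \det (cross_mx r b).
Proof.
rewrite (expand_det_row _ ord_max); apply: eq_bigr => j _.
rewrite mxE [in RHS]mxE eqxx /cofactor; congr (_ * (_ * _)); congr (\det _).
by apply/matrixP => i k; rewrite !mxE eq_sym (negbTE (neq_lift _ _)).
Qed.

Lemma dot_row_cross r (i : nat) : (i < e)%N -> dot (r i) (cross r) = 0.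
Proof.
move=> ie; have ie1 := ltnW ie : (i < e.+1)%N; rewrite dot_cross.
have ne : Ordinal ie1 != ord_max by rewrite -val_eqE /= ltn_eqF.
by apply: (determinant_alternate ne) => j; rewrite !mxE (negbTE ne) eqxx.
Qed.

Lemma mul_cross_mx r b z : cross_mx r b *m z^T =
  \col_i dot (if i == ord_max then b else r i) z.
Proof.
by apply/colP => i; rewrite !mxE; apply: eq_bigr => j _; rewrite !mxE.
Qed.

Lemma cross_eq0 r b z : dot b (cross r) != 0 ->
  (forall i, (i < e)%N -> dot (r i) z = 0) -> dot b z = 0 -> z = 0.
Proof.
rewrite dot_cross => D0 rz bz; apply: trmx_inj; rewrite trmx0.
have U : cross_mx r b \in unitmx by rewrite unitmxE unitfE.
rewrite -[LHS](mulKmx U) mul_cross_mx (_ : \col_i _ = 0) ?mulmx0 //.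
apply/colP => i; rewrite !mxE; case: eqVneq => // ne; apply: rz.
by rewrite ltn_neqAle -ltnS ltn_ord andbT.
Qed.

(** Being determinants, the numbers [dot b (cross r)] depend continuously on
    [r]; this lemma and [cross_kernel] convert between their nonvanishing and
    the statement that the first [e] vectors of [r] cut out exactly one line,
    transversal to the kernel of [b]. *)
Lemma cross_neq0 r b :
  (forall z, (forall i, (i < e)%N -> dot (r i) z = 0) -> dot b z = 0 -> z = 0) ->
  dot b (cross r) != 0.
Proof.
rewrite dot_cross => triv; rewrite -det_tr; apply/negP => /det0P[z z0 zA].
case/negP: z0; have zAT : cross_mx r b *m z^T = 0.
  by rewrite -[cross_mx _ _]trmxK -trmx_mul zA trmx0.
have rows (i : 'I_e.+1) : dot (if i == ord_max then b else r i) z = 0.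
  by have := congr1 (fun M : 'cV[R]_e.+1 => M i 0) zAT; rewrite mul_cross_mx !mxE.
apply/eqP/triv => [i ie|]; last by have := rows ord_max; rewrite eqxx.
have := rows (Ordinal (ltnW ie : (i < e.+1)%N)); rewrite -val_eqE /= ltn_eqF //.
Qed.

Lemma cross_kernel r b z : dot b (cross r) != 0 ->
  (forall i, (i < e)%N -> dot (r i) z = 0) ->
  z = (dot b z / dot b (cross r)) *: cross r.
Proof.
move=> D0 rz; apply/eqP; rewrite -subr_eq0; apply/eqP/(cross_eq0 D0) => [i ie|].
  by rewrite dotBr dotZr dot_row_cross // rz // mulr0 subr0.
by rewrite dotBr dotZr divfK ?subrr.
Qed.

Lemma continuous_dot_cross (T : topologicalType) (r : T -> nat -> V)
    (b : T -> V) (x : T) :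
  (forall i j, {for x, continuous (fun t => r t i 0 j)}) ->
  (forall j, {for x, continuous (fun t => b t 0 j)}) ->
  {for x, continuous (fun t => dot (b t) (cross (r t)))}.
Proof.
move=> cr cb; rewrite /prop_for /continuous_at /= dot_cross.
under eq_cvg do rewrite dot_cross.
apply: (@continuous_det R T e.+1 (fun t => cross_mx (r t) (b t))) => i j.
rewrite /prop_for /continuous_at /= mxE; under eq_cvg do rewrite mxE.
by case: ifP => _; [exact: cb|exact: cr].
Qed.

End CrossProduct.

(** The rows [(a j, 1)] are linearly independent, and a column of a right
    inverse of their matrix is the required affine function. *)
Lemma affinely_independent_dual (R : realType) d m (a : 'I_m.+1 -> 'rV[R]_d) :
  affinely_independent a -> exists u : 'rV[R]_d * R,
    forall j, affine_eval u (a j) = (j == ord0)%:R.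
Proof.
move=> ai; pose A := row_mx (\matrix_i a i) (const_mx 1) : 'M[R]_(m.+1, d + 1).
have /row_freeP[B AB] : row_free A.
  apply: inj_row_free => c cA.
  have /eq_row_mx[cM c1] : row_mx (c *m \matrix_i a i) (c *m const_mx 1) =
      row_mx 0 0 :> 'M[R]_(1, d + 1) by rewrite -mul_mx_row cA row_mx0.
  apply/rowP => i; rewrite mxE; apply: (ai (fun i => c 0 i)).
    have := congr1 (fun M : 'rV[R]_1 => M 0 0) c1; rewrite !mxE => c1'.
    by rewrite -[RHS]c1'; apply: eq_bigr => j _; rewrite mxE mulr1.
  rewrite -[RHS]cM mulmx_sum_row; apply: eq_bigr => j _.
  by congr (_ *: _); apply/rowP => l; rewrite !mxE.
exists ((usubmx (col ord0 B))^T, - dsubmx (col ord0 B) 0 0) => j.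
have := congr1 (fun M : 'M[R]_m.+1 => M j 0) AB; rewrite !mxE => <-.
rewrite big_split_ord /= big_ord1 row_mxEr !mxE mul1r /affine_eval opprK; congr (_ + _).
by rewrite dotC; apply: eq_bigr => i _; rewrite row_mxEl !mxE.
Qed.

(** * Chains of rays in tilted hyperplanes *)

(** The geometric core, stripped of visibility.  For a window [w] of [e.+2]
    indices, [f w] is an affine function vanishing at all the points of [w] and
    positive at all points of smaller index, while [g w] is used to tilt its zero
    set around all the points of [w] but the first, to which it gives a positive
    value.  The tilted hyperplanes of the windows of a tuple [s] that start at its
    first [e.+1] places share the point [p s_(e+1)] and meet in a line through it;
    [ray] is a direction vector of that line, pointing away from [p s_e].  The next
    tilted hyperplane misses [p s_(e+1)] by a little, and cuts the ray close to
    it.  The predicate [close] leaves open how close that has to be. *)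
Section Rays.
Variables (R : realType) (e n : nat).
Local Notation V := 'rV[R]_e.+2.
Variables (p : nat -> V) (f g : seq nat -> V * R).

Local Notation ev := affine_eval.

Hypothesis f_vanishes : forall w j, size w = e.+2 -> incr_below n w ->
  (j < e.+2)%N -> ev (f w) (p (nth 0%N w j)) = 0.
Hypothesis f_gt0 : forall w i, size w = e.+2 -> incr_below n w ->
  (i < nth 0%N w 0)%N -> 0 < ev (f w) (p i).
Hypothesis f_span : forall w z, size w = e.+2 -> incr_below n w ->
  dot (f w).1 z = 0 ->
  exists c : nat -> R,
    z = \sum_(j < e.+1) c j *: (p (nth 0%N w j) - p (nth 0%N w e.+1)).
Hypothesis g_first : forall w, size w = e.+2 -> incr_below n w ->
  ev (g w) (p (nth 0%N w 0)) = 1.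
Hypothesis g_vanishes : forall w j, size w = e.+2 -> incr_below n w ->
  (0 < j < e.+2)%N -> ev (g w) (p (nth 0%N w j)) = 0.

Variable close : V -> V -> R -> Prop.
Hypothesis close_near : forall i u, (i < n)%N -> u != 0 ->
  exists2 eta : R, 0 < eta & forall t, 0 < t < eta -> close (p i) u t.

Definition window k (s : seq nat) := take e.+2 (drop k s).

(** All windows with the same first index are tilted by the same amount. *)
Definition tilted (delta : nat -> R) w : V * R :=
  ((f w).1 + delta (nth 0%N w 0) *: (g w).1,
   (f w).2 + delta (nth 0%N w 0) * (g w).2).

Definition normals delta s (k : nat) : V := (tilted delta (window k s)).1.

(** The direction of the ray before any tilting, and the vector that orients
    the ray after tilting. *)
Definition step s : V := p (nth 0%N s e.+1) - p (nth 0%N s e).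

Definition ray delta s : V :=
  dot (step s) (cross (normals delta s)) *: cross (normals delta s).

(** The two open conditions on the tilts: the first makes the rays well defined,
    the second makes each ray run into the hyperplane of the next window. *)
Definition transversal delta := forall s, incr_below n s ->
  (e.*2.+2 <= size s)%N -> dot (step s) (cross (normals delta s)) != 0.

Definition descending delta := forall s, incr_below n s ->
  (e.*2.+3 <= size s)%N -> dot (tilted delta (window e.+1 s)).1 (ray delta s) < 0.

(** The last clause says that the intersection point lies before the next
    point [p s_(e+2)] on the line along which the next ray leaves it. *)
Definition meets delta s t :=
  let y := p (nth 0%N s e.+1) + t *: ray delta s in
  [/\ 0 < t, close (p (nth 0%N s e.+1)) (ray delta s) t,
      ev (tilted delta (window e.+1 s)) y = 0 &
      0 < dot (step (behead s)) (p (nth 0%N s e.+2) - y)].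

Lemma size_window k s : (k + e.+2 <= size s)%N -> size (window k s) = e.+2.
Proof. by move=> ks; rewrite size_takel // size_drop; lia. Qed.

Lemma nth_window k s j : (j < e.+2)%N ->
  nth 0%N (window k s) j = nth 0%N s (k + j).
Proof. by move=> je; rewrite nth_take // nth_drop. Qed.

Lemma incr_below_window k s : incr_below n s -> incr_below n (window k s).
Proof. by move=> si; apply/incr_below_take/incr_below_drop. Qed.

Lemma window_behead k s : window k (behead s) = window k.+1 s.
Proof. by rewrite /window -drop1 drop_drop addn1. Qed.

Lemma ev_tilted delta w x :
  ev (tilted delta w) x = ev (f w) x + delta (nth 0%N w 0) * ev (g w) x.
Proof. by rewrite /affine_eval /= dotDl dotZl; ring. Qed.

Lemma f_window_eq0 k s j : incr_below n s -> (k + e.+2 <= size s)%N ->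
  (k <= j < k + e.+2)%N -> ev (f (window k s)) (p (nth 0%N s j)) = 0.
Proof.
move=> si ks /andP[kj jk]; rewrite -(subnKC kj) -nth_window; last by lia.
apply: f_vanishes; [exact: size_window|exact: incr_below_window|lia].
Qed.

Lemma f_window_gt0 k s j : incr_below n s -> (k + e.+2 <= size s)%N ->
  (j < k)%N -> 0 < ev (f (window k s)) (p (nth 0%N s j)).
Proof.
move=> si ks jk; apply: f_gt0; [exact: size_window|exact: incr_below_window|].
by rewrite nth_window // addn0; apply: (incr_below_ltn si) => //; lia.
Qed.

Lemma tilted_window_eq0 delta k s j : incr_below n s ->
  (k + e.+2 <= size s)%N -> (k < j < k + e.+2)%N ->
  ev (tilted delta (window k s)) (p (nth 0%N s j)) = 0.
Proof.
move=> si ks /andP[kj jk]; rewrite ev_tilted f_window_eq0 ?(ltnW kj) //.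
rewrite -(subnKC (ltnW kj)) -(nth_window k) ?g_vanishes ?mulr0 ?addr0 //.
- exact: size_window.
- exact: incr_below_window.
- by lia.
- by lia.
Qed.

Lemma normals_behead delta s : normals delta (behead s) = normals delta s \o succn.
Proof. by apply/funext => k; rewrite /normals /= window_behead. Qed.

Lemma dot_normals_ray delta s k : (k < e.+1)%N ->
  dot (normals delta s k) (ray delta s) = 0.
Proof. by move=> ke; rewrite dotZr dot_row_cross // mulr0. Qed.

Lemma ray_neq0 delta s : transversal delta -> incr_below n s ->
  (e.*2.+2 <= size s)%N -> ray delta s != 0.
Proof.
move=> tr si ss; have D := tr _ si ss; rewrite scaler_eq0 negb_or D.
by apply: contra_neq D => ->; rewrite dot0r.
Qed.

Lemma step_neq0 s : incr_below n s -> (e.*2.+2 <= size s)%N -> step s != 0.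
Proof.
move=> si ss; have wi := incr_below_window e si.
have ws : size (window e s) = e.+2 by apply: size_window; lia.
rewrite subr_eq0; apply/eqP => pp; have := g_first ws wi.
have := g_vanishes ws wi (isT : (0 < 1 < e.+2)%N).
by rewrite !nth_window // addn0 addn1 pp => ->; apply/eqP; rewrite eq_sym oner_eq0.
Qed.

(** The ray of [s] only sees the tilts of the first [e.+1] indices of [s]: this
    is why the tilts can be chosen one index at a time. *)
Lemma eq_ray delta delta' s :
  (forall j, (j <= e)%N -> delta (nth 0%N s j) = delta' (nth 0%N s j)) ->
  ray delta s = ray delta' s.
Proof.
move=> dd; rewrite /ray (@cross_ext _ _ _ (normals delta' s)) // => k ke.
by rewrite /normals /tilted nth_window // addn0 dd.
Qed.

Lemma ray_take delta s : ray delta (take e.*2.+2 s) = ray delta s.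
Proof.
rewrite /ray /step !nth_take; try by lia.
rewrite (@cross_ext _ _ _ (normals delta s)) // => k ke.
rewrite /normals; congr (tilted _ _).1; rewrite /window.
by rewrite !take_drop take_takel //; lia.
Qed.

Lemma normals0 s k : normals (fun=> 0) s k = (f (window k s)).1.
Proof. by rewrite /normals /= scale0r addr0. Qed.

(** Without tilts, the hyperplanes of the first windows meet in the line through
    [p s_e] and [p s_(e+1)]: write a common direction in terms of the points of
    the first window; counting from zero, functional number [m.+1] is positive
    at point number [m] and vanishes at all later ones, which kills the
    coefficients in turn. *)
Lemma transversal0 : transversal (fun=> 0).
Proof.
move=> s si ss; apply: cross_neq0 => z rz bz.
have sz0 : (0 + e.+2 <= size s)%N by lia.
have [c zE] : exists c : nat -> R,
    z = \sum_(j < e.+1) c j *: (p (nth 0%N s j) - p (nth 0%N s e.+1)).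
  have r0 : dot (f (window 0 s)).1 z = 0 by rewrite -normals0 rz.
  have [c ->] := f_span (size_window sz0) (incr_below_window 0 si) r0.
  by exists c; apply: eq_bigr => j _; rewrite !nth_window // ltnW // ltnS.
have c0 m : (m <= e)%N -> forall j, (j < m)%N -> c j = 0.
  elim: m => // m IHm me j; rewrite ltnS leq_eqVlt => /predU1P[->{j}|]; last first.
    exact/IHm/ltnW.
  have sm : (m.+1 + e.+2 <= size s)%N by lia.
  have me1 : (m < e.+1)%N by lia.
  have := rz m.+1 me; rewrite normals0 zE dot_sumr (bigD1 (Ordinal me1)) //=.
  rewrite big1 => [|i im]; last first.
    rewrite dotZr; have [lt_im|] := ltnP i m.
      by rewrite (IHm _ i lt_im) ?mul0r // ltnW.
    rewrite leq_eqVlt eq_sym => /predU1P[iE|lt_mi].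
      by rewrite -val_eqE /= iE eqxx in im.
    rewrite dot_affine !f_window_eq0 ?subrr ?mulr0 //; have := ltn_ord i; lia.
  rewrite addr0 dotZr dot_affine (@f_window_eq0 _ _ e.+1) ?subr0 //; last by lia.
  move/eqP; rewrite mulf_eq0 => /orP[/eqP //|/eqP f0].
  by have := f_window_gt0 si sm (ltnSn m); rewrite f0 ltxx.
have zE' : z = - c e *: step s.
  rewrite zE big_ord_recr /= big1 ?add0r => [|i _]; last by rewrite (c0 e) ?scale0r.
  by rewrite /step scaleNr -scalerN opprB.
move/eqP: bz; rewrite zE' dotZr mulf_eq0 => /orP[/eqP ->|]; first by rewrite scale0r.
by rewrite (gt_eqF (dot_gt0 (step_neq0 si ss))).
Qed.

(** Without tilts, the ray of [s] is a positive multiple of [step s], and the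
    functional of the next window decreases from a positive value at [p s_e]
    to zero at [p s_(e+1)]. *)
Lemma descending0 : descending (fun=> 0).
Proof.
move=> s si ss; rewrite /= scale0r addr0.
have ss' : (e.*2.+2 <= size s)%N by lia.
have D0 := transversal0 si ss'; set D := dot _ _ in D0.
have v0K k : (k < e.+1)%N -> dot (normals (fun=> 0) s k) (step s) = 0.
  by move=> ke; rewrite normals0 dot_affine !f_window_eq0 ?subrr //; lia.
have N0 := dot_gt0 (step_neq0 si ss').
have -> : ray (fun=> 0) s = (D ^+ 2 / dot (step s) (step s)) *: step s.
  rewrite [in RHS](cross_kernel D0 v0K) -/D !scalerA; congr (_ *: _).
  rewrite -!(cross_kernel D0 v0K) -/D; field.
  by rewrite D0 gt_eqF.
rewrite dotZr pmulr_rlt0; last by rewrite divr_gt0 // exprn_even_gt0.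
rewrite dot_affine f_window_eq0 //; [|lia|lia].
by rewrite sub0r oppr_lt0 f_window_gt0 //; lia.
Qed.

Definition update (delta : nat -> R) i x := fun j => if j == i then x else delta j.

Lemma continuous_update (delta : nat -> R) i j (x : R) :
  {for x, continuous (fun t => update delta i t j)}.
Proof.
rewrite /prop_for /continuous_at /update; case: eqP => _; last exact: cst_continuous.
exact: cvg_id.
Qed.

Lemma continuous_tilted delta i w (j : 'I_e.+2) (x : R) :
  {for x, continuous (fun t => (tilted (update delta i t) w).1 0 j)}.
Proof.
rewrite /prop_for /continuous_at /= !mxE.
under eq_cvg do rewrite !mxE.
apply: cvgD; first exact: cvg_cst.
by apply: cvgM; [exact: continuous_update|exact: cvg_cst].
Qed.

Lemma continuous_dot_normals delta i s (b : R -> V) (x : R) :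
  (forall j, {for x, continuous (fun t => b t 0 j)}) ->
  {for x, continuous (fun t => dot (b t) (cross (normals (update delta i t) s)))}.
Proof. by apply: continuous_dot_cross => k j; exact: continuous_tilted. Qed.

Lemma update_id delta i : update delta i (delta i) = delta.
Proof. by apply/funext => j; rewrite /update; case: eqP => // ->. Qed.

Lemma near_transversal delta i : delta i = 0 -> transversal delta ->
  \forall x \near (0 : R), transversal (update delta i x).
Proof.
move=> di tr.
apply: (near_incr_below (F := nbhs (0 : R)) (P := fun s x => (e.*2.+2 <= size s)%N ->
  dot (step s) (cross (normals (update delta i x) s)) != 0)) => s si.
have [ss|] := leqP e.*2.+2 (size s); last by move=> _; apply: nearW.
have c : {for 0, continuous (fun t =>
    dot (step s) (cross (normals (update delta i t) s)))}.
  by apply: continuous_dot_normals => j; exact: cst_continuous.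
have := cvgr_neq0 _ c; rewrite -[X in update _ _ X]di update_id => /(_ _ (tr _ si ss)).
by apply: filterS.
Qed.

Lemma near_descending delta i : delta i = 0 -> descending delta ->
  \forall x \near (0 : R), descending (update delta i x).
Proof.
move=> di ds.
apply: (near_incr_below (F := nbhs (0 : R)) (P := fun s x => (e.*2.+3 <= size s)%N ->
  dot (tilted (update delta i x) (window e.+1 s)).1
    (ray (update delta i x) s) < 0)) => s si.
have [ss|] := leqP e.*2.+3 (size s); last by move=> _; apply: nearW.
have c : {for 0, continuous (fun t =>
   dot (tilted (update delta i t) (window e.+1 s)).1 (ray (update delta i t) s))}.
  rewrite /prop_for /continuous_at dotZr; under eq_cvg do rewrite dotZr.
  apply: cvgM; apply: continuous_dot_normals => j; first exact: cst_continuous.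
  exact: continuous_tilted.
have := cvgr_lt _ c; rewrite -[X in update _ _ X]di update_id => /(_ _ _ (ds _ si ss)).
by apply: filterS.
Qed.

(** Tilting by [x] gives the functional of the next window the value [x] at
    [p i], and it decreases along the ray at a rate close to [- a], where [a < 0]
    is its derivative before tilting.  So it vanishes at the parameter
    [tau x = x / - (a + x * b)], which tends to 0 with [x]. *)
Lemma near_meets delta i : delta i = 0 -> transversal delta -> descending delta ->
  \forall x \near (0 : R)^'+, forall s, incr_below n s ->
    (e.*2.+3 <= size s)%N -> nth 0%N s e.+1 = i ->
    exists t, meets (update delta i x) s t.
Proof.
move=> di tr ds.
apply: (near_incr_below (F := (0 : R)^'+) (P := fun s x => (e.*2.+3 <= size s)%N ->
  nth 0%N s e.+1 = i -> exists t, meets (update delta i x) s t)) => s si.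
have [ss|] := leqP e.*2.+3 (size s); last by move=> _; apply: nearW.
have [sE|ne] := eqVneq (nth 0%N s e.+1) i; last first.
  by apply: nearW => x _ sE; rewrite sE eqxx in ne.
have ss' : (e.*2.+2 <= size s)%N by lia.
set u := ray delta s; set w := window e.+1 s.
have rE x : ray (update delta i x) s = u.
  apply: eq_ray => j je; rewrite /update -sE ltn_eqF //.
  by apply: (incr_below_ltn si); lia.
have i_lt : (i < n)%N by rewrite -sE; apply: (incr_below_nth si); lia.
have [eta eta0 close_eta] := close_near i_lt (ray_neq0 tr si ss').
set a := dot (f w).1 u; set b := dot (g w).1 u.
have w0 : nth 0%N w 0 = i by rewrite nth_window // addn0.
have a0 : a < 0.
  by have := ds _ si ss; rewrite -/w -/u /tilted /= w0 di scale0r addr0.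
pose tau x := x / - (a + x * b).
set v := step (behead s).
have v0 : 0 < dot v v.
  by apply/dot_gt0/step_neq0; rewrite ?size_behead; [exact: incr_below_behead|lia].
have cden : (fun x : R => - (a + x * b)) x @[x --> 0] --> - (a + 0 * b).
  apply: cvgN; apply: cvgD; first exact: cvg_cst.
  by apply: cvgM; [exact: cvg_id|exact: cvg_cst].
rewrite mul0r addr0 in cden.
have ctau : tau x @[x --> 0] --> 0.
  rewrite -[X in _ --> X](mul0r (- a)^-1).
  by apply: cvgM; [exact: cvg_id|apply: cvgV => //; rewrite oppr_eq0 lt_eqF].
have cdot : (dot v v - tau x * dot v u) @[x --> 0] --> dot v v.
  rewrite -[X in _ --> X]subr0 -[X in _ - X](mul0r (dot v u)).
  by apply: cvgB; [exact: cvg_cst|apply: cvgM => //; exact: cvg_cst].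
have den_gt0 : \forall x \near (0 : R)^'+, 0 < - (a + x * b).
  by apply: cvg_within; apply: (cvgr_gt _ cden); rewrite oppr_gt0.
have tau_lt : \forall x \near (0 : R)^'+, tau x < eta.
  by apply: cvg_within; apply: (cvgr_lt _ ctau).
have dot_gt0 : \forall x \near (0 : R)^'+, 0 < dot v v - tau x * dot v u.
  by apply: cvg_within; apply: (cvgr_gt _ cdot).
near=> x => _ _.
have x0 : 0 < x by near: x; exact: nbhs_right_gt.
have den0 : 0 < - (a + x * b) by near: x.
have t0 : 0 < tau x by rewrite divr_gt0.
exists (tau x); rewrite /meets rE sE -/w; split => //.
- by apply: close_eta; rewrite t0; near: x.
- rewrite affine_evalD ev_tilted w0 /update eqxx /= w0 eqxx dotZr dotDl dotZl -/a -/b.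
  rewrite -{1}sE f_window_eq0 //; [|lia|lia].
  rewrite -{1}w0 g_first ?size_window //; [|lia|exact: incr_below_window].
  rewrite /tau; field.
  by apply/eqP => den; move: den0; lra.
- have -> : p (nth 0%N s e.+2) - (p i + tau x *: u) = v - tau x *: u.
    by rewrite /v /step !nth_behead sE opprD addrA.
  by rewrite dotBr dotZr -/v; near: x.
Unshelve. all: by end_near. Qed.

(** The tilts of indices at least [m] are still zero.  A positive tilt of index [m]
    that is small enough preserves the two open conditions, gives the
    intersection points near [p m], and does not move the earlier ones. *)
Lemma exists_meeting_tilts m : (m <= n)%N -> exists delta,
  [/\ transversal delta, descending delta, (forall j, (m <= j)%N -> delta j = 0) &
   forall s, incr_below n s -> (e.*2.+3 <= size s)%N ->
     (nth 0%N s e.+1 < m)%N -> exists t, meets delta s t].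
Proof.
elim: m => [_|m IHm mn].
  by exists (fun=> 0); split; [exact: transversal0|exact: descending0| |].
have [delta [tr ds d0 mt]] := IHm (ltnW mn).
have dm := d0 m (leqnn m).
have nt : \forall x \near (0 : R)^'+, transversal (update delta m x).
  by apply: cvg_within; exact: near_transversal.
have nd : \forall x \near (0 : R)^'+, descending (update delta m x).
  by apply: cvg_within; exact: near_descending.
have [x [[xt xd] xm]] : exists x : R,
    (transversal (update delta m x) /\ descending (update delta m x)) /\
    forall s, incr_below n s -> (e.*2.+3 <= size s)%N -> nth 0%N s e.+1 = m ->
      exists t, meets (update delta m x) s t.
  apply: (@filter_ex _ (0 : R)^'+); apply: filterI; first exact: filterI.
  exact: near_meets.
exists (update delta m x); split => // [j mj|s si ss].
  by rewrite /update gtn_eqF // d0 // ltnW.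
rewrite ltnS leq_eqVlt => /predU1P[sE|lt]; first exact: xm.
have [t mtt] := mt _ si ss lt; exists t.
have upd j : (j <= e.+1)%N ->
    delta (nth 0%N s j) = update delta m x (nth 0%N s j).
  move=> je; rewrite /update ltn_eqF // (leq_ltn_trans _ lt) //.
  move: je; rewrite leq_eqVlt => /predU1P[->//|je].
  by apply: ltnW; apply: (incr_below_ltn si); lia.
rewrite /meets -(@eq_ray delta) => [|j je]; last by apply: upd; lia.
rewrite (_ : tilted (update delta m x) (window e.+1 s) =
  tilted delta (window e.+1 s)) //.
by rewrite /tilted nth_window // addn0 upd.
Qed.

Lemma chained_rays : exists v : seq nat -> V,
  [/\ forall s, incr_below n s -> (e.*2.+2 <= size s)%N -> v s != 0,
      forall s, v (take e.*2.+2 s) = v s &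
      forall s, incr_below n s -> (e.*2.+3 <= size s)%N ->
        exists t r, [/\ 0 < t, 0 < r, close (p (nth 0%N s e.+1)) (v s) t &
          p (nth 0%N s e.+1) + t *: v s =
          p (nth 0%N s e.+2) - r *: v (behead s)]].
Proof.
have [delta [tr ds _ mt]] := exists_meeting_tilts (leqnn n).
exists (ray delta); split => [s||s si ss].
- exact: ray_neq0.
- exact: ray_take.
have [|t [t0 close_t hy dy]] := mt s si ss; first by apply: (incr_below_nth si); lia.
set y := _ + _ in hy dy *.
have si' := incr_below_behead si.
have ss' : (e.*2.+2 <= size (behead s))%N by rewrite size_behead; lia.
have D0 := tr _ si' ss'; set z := y - p (nth 0%N s e.+2).
have kz k : (k < e.+1)%N -> dot (normals delta (behead s) k) z = 0.
  move=> ke; rewrite normals_behead /= /normals dot_affine.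
  rewrite (@tilted_window_eq0 _ _ _ e.+2) //; [|lia|lia].
  rewrite subr0; move: ke; rewrite ltnS leq_eqVlt => /predU1P[->|ke]; first exact: hy.
  rewrite affine_evalD tilted_window_eq0 //; [|lia|lia].
  by rewrite add0r dotZr (dot_normals_ray _ _ (_ : (k.+1 < e.+1)%N)) ?mulr0.
(* The point y lies on all the hyperplanes that define the next ray, hence on
   its line; the last clause of meets puts it before the start of that ray. *)
set D := dot (step (behead s)) _ in D0.
exists t, (dot (step (behead s)) (- z) / D ^+ 2); split => //.
  by rewrite divr_gt0 ?exprn_even_gt0 // opprB.
have zE : (dot (step (behead s)) (- z) / D ^+ 2) *: ray delta (behead s) = - z.
  rewrite [in RHS](cross_kernel D0 kz) -/D /ray -/D scalerA dotNr -scaleNr.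
  by congr (_ *: _); field.
by rewrite zE opprK [RHS]addrC /z subrK.
Qed.

End Rays.

(** * Colours near a one-point hole *)

Lemma near_at_right0 (R : realType) (P : R -> Prop) :
  (\forall t \near (0 : R)^'+, P t) ->
  exists2 eta : R, 0 < eta & forall t, 0 < t < eta -> P t.
Proof.
move/nbhs_ballP => [eta /= eta0 H]; exists eta => // t /andP[t0 te].
by apply: H => //=; rewrite /ball /= sub0r normrN gtr0_norm.
Qed.

Section Holes.
Variables (R : realType) (d : nat) (X : set 'rV[R]_d).
Implicit Types (q u : 'rV[R]_d) (t r eps : R).

(** Otherwise the hole could escape along the ray. *)
Lemma hole_ray_meets q u eps : one_point_holes X q -> u != 0 -> 0 < eps ->
  exists2 t, 0 < t < eps & X (q + t *: u).
Proof.
move=> [Xq comp] u0 eps0; apply/not_exists2P => noX.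
have he0 : 0 < eps / 2 by rewrite divr_gt0.
suff : path_component (~` X) q (q + (eps / 2) *: u).
  rewrite comp /= => /eqP; rewrite -subr_eq0 addrAC subrr add0r scaler_eq0.
  by rewrite (negbTE u0) gt_eqF.
exists (fun t => q + (t * (eps / 2)) *: u); split.
- apply: continuous_subspaceT => t; apply: cvgD; first exact: cvg_cst.
  apply: cvgZr_tmp; apply: cvgM; [exact: cvg_id|exact: cvg_cst].
- by rewrite mul0r scale0r addr0.
- by rewrite mul1r.
move=> t /andP[t0 t1] Xt; move: t0; rewrite le_eqVlt => /predU1P[t0|t0].
  by move: Xt; rewrite -t0 mul0r scale0r addr0.
case: (noX (t * (eps / 2))) => //; apply: contra_notP.
by move=> _; rewrite mulr_gt0 //=; nra.
Qed.

Variables (k : nat) (c : 'rV[R]_d -> nat).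
Hypothesis c_lt : forall x, X x -> (c x < k)%N.
Hypothesis c_proper : forall x y, X x -> X y -> ~ sees X x y -> c x <> c y.

Lemma color_neq_across q u t r : ~ X q -> 0 < t -> 0 < r ->
  X (q + t *: u) -> X (q - r *: u) -> c (q + t *: u) <> c (q - r *: u).
Proof.
move=> Xq t0 r0 Xt Xr; apply: c_proper => // /(_ (t / (t + r))) sXq.
have tr0 : t + r != 0 by rewrite gt_eqF // addr_gt0.
apply: Xq.
have -> : q = (1 - t / (t + r)) *: (q + t *: u) + (t / (t + r)) *: (q - r *: u).
  rewrite !scalerDr addrACA -scalerDl subrK scale1r.
  rewrite -[- (r *: u)]scaleNr !scalerA -scalerDl.
  have -> : (1 - t / (t + r)) * t + t / (t + r) * - r = 0 by field.
  by rewrite scale0r addr0.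
apply: sXq; apply/andP; split; first by apply: divr_ge0; lra.
by rewrite ler_pdivrMr ?addr_gt0 //; lra.
Qed.

Definition ray_colors q u : {set 'I_k} :=
  [set a : 'I_k | `[< forall eps : R, 0 < eps -> exists2 t, 0 < t < eps &
     X (q + t *: u) /\ c (q + t *: u) = a >] ]%SET.

(** Only finitely many colours can fail to accumulate, and they are absent near
    [q].  Some colour does accumulate, and between two points of this colour on
    the ray all points belong to [X]. *)
Lemma ray_colorsP q u : one_point_holes X q -> u != 0 ->
  exists2 eta : R, 0 < eta & forall t, 0 < t < eta ->
    X (q + t *: u) /\ exists2 a : 'I_k, a \in ray_colors q u & c (q + t *: u) = a.
Proof.
move=> hq u0.
have /near_at_right0[eta eta0 H] : \forall t \near (0 : R)^'+, forall a : 'I_k,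
    a \notin ray_colors q u -> X (q + t *: u) -> c (q + t *: u) <> a.
  apply: filter_forall => a; have [aS|aS] := boolP (a \in ray_colors q u).
    exact: nearW.
  move: (aS); rewrite inE => /asboolPn/existsNP[eps /not_implyP[eps0 /forall2NP noa]].
  near=> t => _ Xt ct; have [nt|nX] := noa t; last by apply: nX.
  by apply: nt; apply/andP; split; near: t; [exact: nbhs_right_gt|exact: nbhs_right_lt].
have colS t : 0 < t < eta -> X (q + t *: u) ->
    exists2 a : 'I_k, a \in ray_colors q u & c (q + t *: u) = a.
  move=> teta Xt; exists (Ordinal (c_lt Xt)) => //.
  by apply/negPn/negP => aS; apply: (H _ teta _ aS Xt).
have [t0 t0eta Xt0] := hole_ray_meets hq u0 eta0.
have /andP[t0_gt0 t0_lt] := t0eta.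
have [a aS ca] := colS _ t0eta Xt0.
exists t0 => // t /andP[t_gt0 tt0].
suff Xt : X (q + t *: u).
  by split => //; apply: colS => //; rewrite t_gt0 (lt_trans tt0).
move: aS; rewrite inE => /asboolP/(_ t t_gt0)[t1 /andP[t1_gt0 t1t] [Xt1 ct1]].
have : sees X (q + t1 *: u) (q + t0 *: u).
  by apply: contrapT => /(c_proper Xt1 Xt0); rewrite ca ct1.
move/(_ ((t - t1) / (t0 - t1))).
have dne : t0 - t1 != 0 by rewrite subr_eq0 gt_eqF // (lt_trans t1t).
have -> : (1 - (t - t1) / (t0 - t1)) *: (q + t1 *: u) +
    ((t - t1) / (t0 - t1)) *: (q + t0 *: u) = q + t *: u.
  rewrite !scalerDr addrACA -scalerDl subrK scale1r !scalerA -scalerDl.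
  by congr (_ + _ *: _); field.
apply; apply/andP; split; first by apply: divr_ge0; lra.
by rewrite ler_pdivrMr; lra.
Unshelve. all: by end_near. Qed.

Lemma ray_colors_neq0 q u : one_point_holes X q -> u != 0 ->
  ray_colors q u != finset.set0.
Proof.
move=> hq u0; have [eta eta0 H] := ray_colorsP hq u0.
have [|_ [a aS _]] := H (eta / 2); first by rewrite divr_gt0 //=; lra.
by apply/finset.set0Pn; exists a.
Qed.

Lemma ray_colors_across q u r a : ~ X q -> a \in ray_colors q u -> 0 < r ->
  X (q - r *: u) -> c (q - r *: u) <> a.
Proof.
move=> Xq aS r0 Xr; move: aS; rewrite inE.
move=> /asboolP/(_ 1 ltr01)[t /andP[t0 _] [Xt <-]].
exact/nesym/color_neq_across.
Qed.

End Holes.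

(** * Holes on a line *)

(** A point of [X] right after each hole, before the next one, together with a
    point just before the first hole: any two of these [n.+1] points are
    separated by a hole, so they have different colours. *)
Lemma line_holes_lt (R : realType) n (q : 'I_n -> 'rV[R]_1) (X : set 'rV[R]_1) k :
  injective q -> (forall i, one_point_holes X (q i)) ->
  (n = 0%N -> X !=set0) -> invisibility_colorable X k -> (n < k)%N.
Proof.
move=> q_inj hq X0 [c [c_lt c_proper]].
case: (posnP n) => [n0|n_gt0].
  by have [x Xx] := X0 n0; rewrite n0 (leq_ltn_trans _ (c_lt x Xx)).
pose u : 'rV[R]_1 := const_mx 1.
have u0 : u != 0 by apply/eqP => /rowP/(_ 0); rewrite !mxE => /eqP; rewrite oner_eq0.
have uE (x y : 'rV[R]_1) : y = x + (y 0 0 - x 0 0) *: u.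
  by apply/rowP => i; rewrite !ord1 !mxE mulr1 addrC subrK.
pose i0 := [arg min_(i < Ordinal n_gt0) q i 0 0]%O.
have i0_min i : q i0 0 0 <= q i 0 0 by rewrite /i0; case: arg_minP => // j _ ->.
have rightT i : exists t : R, [/\ 0 < t, X (q i + t *: u) &
    forall j, q i 0 0 < q j 0 0 -> t < q j 0 0 - q i 0 0].
  have /near_at_right0[eta eta0 H] : \forall t \near (0 : R)^'+, forall j,
      q i 0 0 < q j 0 0 -> t < q j 0 0 - q i 0 0.
    apply: filter_forall => j.
    have [ij|_] := ltP (q i 0 0) (q j 0 0); last exact: nearW.
    have ij0 : 0 < q j 0 0 - q i 0 0 by rewrite subr_gt0.
    by apply: filterS (nbhs_right_lt ij0).
  have [t teta Xt] := hole_ray_meets (hq i) u0 eta0.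
  by exists t; split => //; [case/andP: teta|exact: H].
have [T TP] := choice rightT.
have Nu0 : - u != 0 by rewrite oppr_eq0.
have [t0 /andP[t0_gt0 _] X0'] := hole_ray_meets (hq i0) Nu0 ltr01.
pose y o := if o is Some i then q i + T i *: u else q i0 + t0 *: - u.
have Xy o : X (y o) by case: o => [i|] //=; have [] := TP i.
have y0 i : c (y (Some i)) <> c (y None).
  have [Ti0 XTi _] := TP i; have := i0_min i => qi.
  have yE : q i + T i *: u = q i0 + (q i 0 0 - q i0 0 0 + T i) *: u.
    by rewrite scalerDl addrA -uE.
  rewrite /= scalerN yE; apply: (color_neq_across c_proper) => //; last 2 first.
  - by rewrite -yE.
  - by rewrite -scalerN.
  - by have [] := hq i0.
  - by rewrite ltr_wpDl ?subr_ge0.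
have yS i j : q i 0 0 < q j 0 0 -> c (y (Some i)) <> c (y (Some j)).
  move=> ij; have [Ti0 XTi /(_ j ij) Tij] := TP i; have [Tj0 XTj _] := TP j.
  have yE : q i + T i *: u = q j - (q j 0 0 - q i 0 0 - T i) *: u.
    by apply/rowP => l; rewrite !ord1 !mxE; ring.
  rewrite /= yE; apply/nesym/(color_neq_across c_proper) => //.
  - by have [] := hq j.
  - by rewrite subr_gt0.
  - by rewrite -yE.
have inj : injective (fun o => Ordinal (c_lt _ (Xy o))).
  move=> o o' /(congr1 val) /=; case: o o' => [i|] [j|] // cc.
  - congr Some; apply: q_inj; rewrite [RHS](uE (q i)).
    case: (ltgtP (q i 0 0) (q j 0 0)) => [/yS //|/yS /nesym //|->].
    by rewrite subrr scale0r addr0.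
  - by have := y0 i.
  - by have := y0 j; rewrite /= -cc.
by have := leq_card _ inj; rewrite card_option !card_ord.
Qed.

(** * Holes in same-side position *)

Lemma mem_affine_hull (R : realType) d k (a : 'I_k -> 'rV[R]_d) j :
  affine_hull a (a j).
Proof.
exists (fun i => (i == j)%:R).
  by rewrite (bigD1 j) //= eqxx big1 ?addr0 // => i /negbTE ->.
rewrite (bigD1 j) //= eqxx scale1r big1 ?addr0 // => i /negbTE ->.
by rewrite scale0r.
Qed.

Section SameSideHoles.
Variables (R : realType) (e n : nat) (q : 'I_n -> 'rV[R]_e.+2).
Hypothesis q_same_side : same_side q.

(** In a same-side tuple the later points are on one side; reversing the order
    puts the earlier ones there, so that tilts can be chosen in increasing order. *)
Definition reversed (i : nat) : 'rV[R]_e.+2 :=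
  if insub i is Some j then q (rev_ord j) else 0.
Local Notation p := reversed.

Definition tuple_of w (sw : size w = e.+2) (wi : incr_below n w) (j : 'I_e.+2) : 'I_n :=
  rev_ord (Ordinal (incr_below_nth wi (eq_ind_r (fun m => j < m)%N (ltn_ord j) sw))).

Lemma reversedE i (ilt : (i < n)%N) : p i = q (rev_ord (Ordinal ilt)).
Proof. by rewrite /p insubT. Qed.

Lemma reversed_nth w (sw : size w = e.+2) (wi : incr_below n w) (j : 'I_e.+2) :
  p (nth 0%N w j) = q (tuple_of sw wi j).
Proof. exact: reversedE. Qed.

Lemma ltn_tuple_of w (sw : size w = e.+2) (wi : incr_below n w) (j k : 'I_e.+2) :
  (j < k)%N -> (tuple_of sw wi k < tuple_of sw wi j)%N.
Proof.
move=> jk /=; have kw : (k < size w)%N by rewrite sw.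
have := incr_below_ltn wi jk kw; have := incr_below_nth wi kw; lia.
Qed.

Lemma same_side_hyperplane w : exists u : 'rV[R]_e.+2 * R,
  size w = e.+2 -> incr_below n w ->
  [/\ forall j, (j < e.+2)%N -> affine_eval u (p (nth 0%N w j)) = 0,
      forall i, (i < nth 0%N w 0)%N -> 0 < affine_eval u (p i) &
      forall z, dot u.1 z = 0 -> exists c : nat -> R,
        z = \sum_(j < e.+1) c j *: (p (nth 0%N w j) - p (nth 0%N w e.+1))].
Proof.
have [sw|ne] := eqVneq (size w) e.+2; last by exists 0 => sw; rewrite sw eqxx in ne.
have [wi|] := boolP (incr_below n w); last by exists 0.
pose idx := tuple_of sw wi \o @rev_ord e.+2.
have idx_incr (j k : 'I_e.+2) : (j < k)%N -> (idx j < idx k)%N.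
  by move=> jk; apply: ltn_tuple_of => /=; have := ltn_ord k; lia.
have [a [b [_ hull pos]]] := q_same_side.2 idx idx_incr.
have pE (j : 'I_e.+2) : p (nth 0%N w j) = q (idx (rev_ord j)).
  by rewrite /idx /= rev_ordK reversed_nth.
have on (j : 'I_e.+2) : dot a (p (nth 0%N w j)) = b.
  have : hyperplane a b (q (idx (rev_ord j))).
    by rewrite -hull; exact: (mem_affine_hull (q \o idx)).
  by rewrite pE.
exists (a, b) => _ _; split=> [j je|i iw|z az].
- by rewrite /affine_eval (on (Ordinal je)) subrr.
- have i_lt : (i < n)%N by rewrite (ltn_trans iw) // (incr_below_nth wi) // sw.
  rewrite /affine_eval subr_gt0 (reversedE i_lt); apply: pos => j /=.
  have jw : (e.+2 - j.+1 < size w)%N by rewrite sw; lia.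
  have := incr_below_nth wi jw.
  have [-> | j0] := posnP (e.+2 - j.+1)%N; first by lia.
  by have := incr_below_ltn wi j0 jw; lia.
have : hyperplane a b (z + p (nth 0%N w e.+1)).
  by rewrite /hyperplane /= dotDr az add0r; exact: (on ord_max).
rewrite -hull => -[c c1 zE]; exists (fun j => c (rev_ord (inord j))).
have c1' : \sum_(j < e.+2) c (rev_ord j) = 1.
  by rewrite -c1 [RHS](reindex_inj rev_ord_inj).
have {}zE : z + p (nth 0%N w e.+1) = \sum_(j < e.+2) c (rev_ord j) *: p (nth 0%N w j).
  rewrite zE (reindex_inj rev_ord_inj); apply: eq_bigr => j _.
  by rewrite pE.
have -> : z = \sum_(j < e.+2) c (rev_ord j) *: (p (nth 0%N w j) - p (nth 0%N w e.+1)).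
  under eq_bigr do rewrite scalerBr.
  by rewrite sumrB -scaler_suml c1' scale1r -zE addrK.
rewrite big_ord_recr /= subrr scaler0 addr0; apply: eq_bigr => j _.
by congr (c (rev_ord _) *: _); apply/val_inj; rewrite /= inordK // ltnW // ltnS ltn_ord.
Qed.

Lemma same_side_dual w : exists u : 'rV[R]_e.+2 * R,
  size w = e.+2 -> incr_below n w ->
  affine_eval u (p (nth 0%N w 0)) = 1 /\
  forall j, (0 < j < e.+2)%N -> affine_eval u (p (nth 0%N w j)) = 0.
Proof.
have [sw|ne] := eqVneq (size w) e.+2; last by exists 0 => sw; rewrite sw eqxx in ne.
have [wi|] := boolP (incr_below n w); last by exists 0.
have inj : injective (tuple_of sw wi).
  move=> j k jk; apply/val_inj; case: (ltngtP j k) => // /(ltn_tuple_of sw wi).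
    by rewrite jk ltnn.
  by rewrite jk ltnn.
have [u uE] := affinely_independent_dual (q_same_side.1 _ _ (leqnSn _) inj).
exists u => _ _; split=> [|j /andP[j0 je]].
  by rewrite (reversed_nth sw wi ord0) (uE ord0) eqxx.
by rewrite (reversed_nth sw wi (Ordinal je)) (uE (Ordinal je)) -val_eqE /= gtn_eqF.
Qed.

(** Colour an [e.*2.+2]-tuple [s] with the set of colours accumulating at the hole
    [p s_(e+1)] along its ray.  This shift colouring is proper: the ray of [s]
    contains a point [y] near that hole, whose colour belongs to the set of [s],
    and which is separated by the hole [p s_(e+2)] from all the points of the
    next ray, so the set of the shifted tuple misses the colour of [y]. *)
Lemma same_side_holes_lt (X : set 'rV[R]_e.+2) k :
  (forall j, one_point_holes X (q j)) -> invisibility_colorable X k ->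
  (n < tower e.*2.+2 k)%N.
Proof.
move=> hq [c [c_lt c_proper]].
have hp i : (i < n)%N -> one_point_holes X (p i).
  by move=> i_lt; rewrite (reversedE i_lt).
have [f fP] := choice same_side_hyperplane.
have [g gP] := choice same_side_dual.
pose E x u t := X (x + t *: u) /\
  exists2 a : 'I_k, a \in ray_colors X k c x u & c (x + t *: u) = a.
have [|||||i u i_lt u0|v [v0 v_take v_chain]] := @chained_rays R e n p f g _ _ _ _ _ E.
- by move=> w j sw wi je; have [H _ _] := fP w sw wi; exact: H.
- by move=> w i sw wi iw; have [_ H _] := fP w sw wi; exact: H.
- by move=> w z sw wi az; have [_ _ H] := fP w sw wi; exact: H.
- by move=> w sw wi; have [H _] := gP w sw wi.
- by move=> w j sw wi je; have [_ H] := gP w sw wi; exact: H.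
- exact: (ray_colorsP c_lt c_proper (hp i i_lt) u0).
pose C s := ray_colors X k c (p (nth 0%N s e.+1)) (v s).
apply: (@leq_ltn_trans (tower e.*2.+1 #|[set~ finset.set0 : {set 'I_k}]%SET|)).
  apply: (@shift_coloring_leq_tower _ _ _ _ C) => s ss si.
    rewrite !inE; apply: (ray_colors_neq0 c_lt c_proper) => //.
      by apply/hp/(incr_below_nth si); rewrite ss; lia.
    by apply: v0; rewrite ?ss.
  have [|t [r [t0 r0 [Xy [a aC ya]] yE]]] := v_chain s si; first by rewrite ss.
  have hole : ~ X (p (nth 0%N s e.+2)).
    by have [] := hp (nth 0%N s e.+2) (incr_below_nth si _) => //; rewrite ss; lia.
  move=> CC; move: aC.
  have -> : ray_colors X k c (p (nth 0%N s e.+1)) (v s) = C (take e.*2.+2 s).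
    by rewrite /C v_take nth_take //; lia.
  rewrite CC /C nth_behead => aC.
  by apply: (ray_colors_across c_proper hole aC r0); rewrite -yE.
rewrite -[tower e.*2.+2 k]towerS ltn_tower // cardsC1 -cardsT.
rewrite -powersetT card_powerset cardsT card_ord.
by rewrite ltn_predL expn_gt0.
Qed.

End SameSideHoles.

(** * Slices by hyperplanes *)

(** Solve the equation of the hyperplane for a coordinate whose coefficient is
    not zero, and use the others as parameters. *)
Lemma hyperplane_chart (R : realType) d (a : 'rV[R]_d.+1) (b : R) : a != 0 ->
  exists phi : 'rV[R]_d -> 'rV[R]_d.+1,
    [/\ injective phi, continuous phi,
        forall t x y, phi ((1 - t) *: x + t *: y) = (1 - t) *: phi x + t *: phi y &
        hyperplane a b `<=` range phi].
Proof.
move=> a0; have [i0 ai0] : exists i0, a 0 i0 != 0.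
  apply/existsP; apply: contraNT a0 => /existsPn a0.
  by apply/eqP/rowP => i; rewrite mxE; apply/eqP/negPn/a0.
pose x0 : 'rV[R]_d.+1 := (b / a 0 i0) *: delta_mx 0 i0.
pose w (j : 'I_d) : 'rV[R]_d.+1 :=
  delta_mx 0 (lift i0 j) - (a 0 (lift i0 j) / a 0 i0) *: delta_mx 0 i0.
pose phi (y : 'rV[R]_d) := x0 + \sum_j y 0 j *: w j.
have phi_lift y j : phi y 0 (lift i0 j) = y 0 j.
  rewrite !mxE eqxx eq_sym (negbTE (neq_lift _ _)) mulr0 add0r summxE (bigD1 j) //=.
  rewrite !mxE !eqxx [lift _ _ == i0]eq_sym (negbTE (neq_lift _ _)) mulr0 subr0 mulr1.
  rewrite big1 ?addr0 // => i ij.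
  rewrite !mxE !eqxx [lift _ _ == i0]eq_sym (negbTE (neq_lift _ _)) mulr0 subr0.
  by rewrite (inj_eq lift_inj) eq_sym (negbTE ij) mulr0.
have phi_i0 y : phi y 0 i0 = (b - \sum_j a 0 (lift i0 j) * y 0 j) / a 0 i0.
  rewrite !mxE !eqxx mulr1 summxE mulrBl; congr (_ + _).
  rewrite mulr_suml -sumrN; apply: eq_bigr => j _.
  by rewrite !mxE !eqxx (negbTE (neq_lift _ _)) add0r mulr1; ring.
exists phi; split.
- by move=> x y xy; apply/rowP => j; rewrite -!phi_lift xy.
- move=> y; apply: (@cvgD _ _ _ (nbhs y) _ (fun=> x0)); first exact: cst_continuous.
  apply: (@continuous_sum R _ _ _ _ _ (fun j (y : 'rV[R]_d) => y 0 j *: w j)) => j.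
  have cj : (fun y : 'rV[R]_d => y 0 j) @ y --> y 0 j by exact: coord_continuous.
  exact: (@cvgZr_tmp _ _ _ _ (nbhs_filter (y : 'rV[R]_d)) _ _ (w j) cj).
- move=> t x y; rewrite /phi !scalerDr addrACA -scalerDl subrK scale1r; congr (_ + _).
  rewrite !scaler_sumr -big_split /=; apply: eq_bigr => j _.
  by rewrite !mxE [LHS]scalerDl !scalerA.
- move=> x; rewrite /hyperplane /= => xab; exists (\row_j x 0 (lift i0 j)) => //.
  apply/rowP => i; case: (unliftP i0 i) => [j|] ->; first by rewrite phi_lift mxE.
  rewrite phi_i0; apply: (mulIf ai0); rewrite divfK //.
  rewrite -xab /dot (bigD1_ord i0) //= mulrC [x 0 i0 * _]mulrC; apply/eqP.
  rewrite subr_eq; apply/eqP; congr (_ + _).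
  by apply: eq_bigr => j _; rewrite mxE.
Qed.

Section Slice.
Variables (R : realType) (d d' : nat) (phi : 'rV[R]_d -> 'rV[R]_d').
Hypotheses (phi_inj : injective phi) (phi_cont : continuous phi)
  (phi_affine : forall t x y,
    phi ((1 - t) *: x + t *: y) = (1 - t) *: phi x + t *: phi y).
Variable X : set 'rV[R]_d'.

Lemma colorable_slice k : invisibility_colorable X k ->
  invisibility_colorable (phi @^-1` X) k.
Proof.
move=> [c [c_lt c_proper]]; exists (c \o phi); split=> [x|x y] Xx; first exact: c_lt.
move=> Xy nsee; apply: c_proper => // see; apply: nsee => t t01.
by rewrite /preimage /= phi_affine; exact: see.
Qed.

(** A path in the complement of the slice is mapped to a path in the complement
    of [X]; so slicing can create holes but cannot destroy one. *)
Lemma hole_slice q : one_point_holes X (phi q) -> one_point_holes (phi @^-1` X) q.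
Proof.
move=> [Xq comp]; split=> //; apply/seteqP; split=> [y [f [fc f0 f1 fX]]|_ ->].
  apply: phi_inj; suff : path_component (~` X) (phi q) (phi y) by rewrite comp.
  exists (phi \o f); split; rewrite /= ?f0 ?f1 //.
  by apply: within_continuous_comp => // x _; exact: phi_cont.
exists (fun=> q); split => //.
by apply: continuous_subspaceT => t; exact: cvg_cst.
Qed.

End Slice.

Lemma least_Some (P : nat -> Prop) n : least P = Some n -> P n.
Proof.
rewrite /least; case: pselect => // ex [<-].
by case: ex_minnP => m /asboolP.
Qed.

Lemma card_eq_II_inj (T : pointedType) (P : set T) m : P #= `I_m ->
  exists2 q : 'I_m -> T, injective q & forall i, P (q i).
Proof.
rewrite card_eq_sym => /card_set_bijP[f [ff fi _]].
exists (fun i => f i) => [i j|i]; last by apply: ff => /=.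
by move/fi => ij; apply/val_inj/ij; rewrite inE /=.
Qed.

Lemma card_eq_II_sub (T : pointedType) (P : set T) l m :
  P #= `I_l -> (m <= l)%N ->
  exists2 Q, Q `<=` P & Q #= `I_m.
Proof.
rewrite card_eq_sym => /card_set_bijP[f [ff fi _]] ml.
have ml' : `I_m `<=` `I_l by move=> i /= /leq_trans; exact.
exists (f @` `I_m) => [_ [i im <-]|]; first exact/ff/ml'.
by apply: inj_card_eq => i j; rewrite !inE => /ml' il /ml' jl; apply: fi; rewrite inE.
Qed.

(** A hyperplane rich in holes lowers the dimension; replacing the exact value of
    the tower by an upper bound [n], kept fixed, lets the same [n] serve in all
    dimensions. *)
Lemma finite_holes_lt (R : realType) m (X P : set 'rV[R]_m.+1) k n G :
  invisibility_colorable X k -> (tower m.*2 k <= n)%N -> (n = 0%N -> X !=set0) ->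
  g R m.+1 n = Some G -> P `<=` one_point_holes X -> ~ (P #= `I_G).
Proof.
elim: m X P G => [|m IHm] X P G colX kn X0 gG PX PG.
  move: gG PG => [<-] /card_eq_II_inj[q q_inj qP].
  have := line_holes_lt q_inj (fun i => PX _ (qP i)) X0 colX.
  by rewrite ltnNge kn.
have un : @unavoidable R m.+2 (g R m.+1 n) n G := least_Some gG.
case: (un P PG) => [[m' [gm' [Q [a [b [QP Qm' a0 Qab]]]]]]|[q [qP sq]]]; last first.
  by have := same_side_holes_lt sq (fun j => PX _ (qP j)) colX; rewrite ltnNge kn.
have [phi [phi_inj phi_cont phi_aff phiS]] := hyperplane_chart b a0.
have Qphi : phi @` (phi @^-1` Q) = Q.
  apply/seteqP; split; first exact: image_preimage_subset.
  move=> x Qx; have [y _ yx] := phiS x (Qab x Qx).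
  by exists y; rewrite // /preimage /= yx.
apply: (IHm (phi @^-1` X) (phi @^-1` Q) _ (colorable_slice phi_aff colX) _ _ gm').
- apply: leq_trans kn; rewrite doubleS.
  by apply: leq_trans (leq_tower _ _) _; exact: leq_tower.
- by move=> n0; move: kn; rewrite n0 doubleS leqn0 /= expn_eq0.
- by move=> y Qy; apply: (hole_slice phi_inj phi_cont); exact/PX/QP.
- apply: card_eq_trans Qm'; rewrite -[X in _ #= X]Qphi card_eq_sym.
  by apply: inj_card_eq => x y _ _; exact: phi_inj.
Qed.

Theorem lemma11 (R : realType) (d : nat) (X : set 'rV[R]_d) (l : nat)
  (d_ge1 : (1 <= d)%N)
  (X_nonempty : d = 1%N -> X !=set0)
  (holes_l : one_point_holes X #= `I_l) :
  lt_enat l (obind (g R d) (omap (tower (2 * d - 2)) (chromatic_number X))).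
Proof.
case: d d_ge1 X X_nonempty holes_l => // m _ X X_nonempty holes_l.
rewrite (_ : 2 * m.+1 - 2 = m.*2)%N; last by lia.
case chi : (chromatic_number X) => [k|//].
case gG : (obind _ _) => [G|//].
rewrite /lt_enat ltnNge; apply/negP => Gl.
have [Q Qholes QG] := card_eq_II_sub holes_l Gl.
apply: (finite_holes_lt (least_Some chi) (leqnn _) _ gG Qholes QG).
case: m X {holes_l Qholes QG chi gG Gl Q} X_nonempty => [X H _|m X _]; first exact: H.
by rewrite doubleS /= => /eqP; rewrite expn_eq0.
Qed.
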